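(* For every odd prime $p>2$, \[ \sum_{k=0}^{\frac{p-1}{2}}\frac{(-1)^k(172k^2+75k+9)}{2^{12k}}\binom{2k}{k}^3\binom{3k}{k}\binom{4k}{2k} \equiv 9p^2+6p^3q_p(2)-9p^4q_p(2)^2 \pmod{p^5}. \]
   Context: For an odd prime $p$, the Fermat quotient is $q_p(2)=\frac{2^{p-1}-1}{p}$. Congruences between rational numbers whose denominators are coprime to $p$ are understood in the ring of $p$-integral rationals. *)

(* Defs.v *)
From HB Require Import structures.
From mathcomp Require Import all_boot all_order all_algebra.
Set Implicit Arguments. Unset Strict Implicit. Unset Printing Implicit Defensive.
Import Order.TTheory GRing.Theory Num.Theory.
Local Open Scope ring_scope.

Definition p_integral (p : nat) (x : rat) : bool :=
  coprime `|denq x|%N p.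

Definition rat_congr (p n : nat) (a b : rat) : bool :=
  p_integral p ((a - b) / (p ^ n)%:R).

Definition fermat_q2 (p : nat) : rat := ((2 ^ p.-1)%:R - 1) / p%:R.

(* Main.v *)
Require Import Defs.
From HB Require Import structures.
From mathcomp Require Import all_boot all_order all_algebra.
From mathcomp Require Import cyclic.
From mathcomp Require Import ring lra zify.
Import Order.TTheory GRing.Theory Num.Theory.
Local Open Scope ring_scope.

(** Write [(y)_n] for the rising factorial. The summand is the value at [y = 1/2]
    of [F(n,y) = c_n (1-y)_n (y)_n^3 (y)_{2n} A(n,y)], where
    [c_n = (-1)^n (3n)! / (n!^3 (2n+1)!^3)] and [A] has degree [4] in [y], and [F]
    has a WZ mate: [S(y) = sum_(n < N) F(n,y)] satisfies [S(y+1) - S(y) = G(y)]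
    for an explicit product [G]. Let [p = 2h+1], [N = h+1] and [P(z) = S(z-h)], so
    that the sum is [P(p/2)]. The zeros of [G] give
    [P(z) = 48 z^2 + O(z^4)] and [P(p) = 0]. Only the last term [n = h] of
    [P] has non-[p]-integral coefficients; it is [p^-2 z W(z)] with [W] integral.
    Interpolating at the quadruple node [0] and at the node [p] therefore gives
    [P(p/2) = 9 p^2 - p^3 W_4 / 32 - 3 p^4 W_5 / 64] modulo [p^5].

    With [D(z) = prod_(1 <= i <= h) (1 - z/i) = 1 - H z + E z^2 - ...], the
    polynomial [W] is a product of values of [D] and of [A], so [W_4] and [W_5]
    are polynomials in [H] and [E] modulo [p^2]. Finally [D(p) = 2^(p-1) D(p/2)]
    expresses [q_p(2)] through [H] and [E], and
    [3 (H^2 - 2 E) = 3 sum_(1 <= i <= h) 1/i^2] vanishes modulo [p]. *)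

(** * Rising factorials and the WZ pair *)

Definition poch {R : comNzRingType} (x : R) (n : nat) : R :=
  \prod_(i < n) (x + i%:R).

Lemma poch0 (R : comNzRingType) (x : R) : poch x 0 = 1.
Proof. by rewrite /poch big_ord0. Qed.

Lemma pochS (R : comNzRingType) (x : R) n : poch x n.+1 = poch x n * (x + n%:R).
Proof. by rewrite /poch big_ord_recr. Qed.

Lemma poch_recl (R : comNzRingType) (x : R) n :
  poch x n.+1 = x * poch (x + 1) n.
Proof.
rewrite /poch big_ord_recl /= addr0; congr (_ * _).
by apply: eq_bigr => i _; rewrite /bump leq0n natrD addrA.
Qed.

Lemma poch_shift (R : comNzRingType) (x : R) n :
  x * poch (x + 1) n = poch x n * (x + n%:R).
Proof. by rewrite -poch_recl pochS. Qed.

Lemma rmorph_poch (R S : comNzRingType) (f : {rmorphism R -> S}) x n :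
  f (poch x n) = poch (f x) n.
Proof.
by rewrite /poch rmorph_prod; apply: eq_bigr => i _; rewrite rmorphD rmorph_nat.
Qed.

(* Found by Gosper summation; [cert n (1/2) = (2 n + 1)^3 (172 n^2 + 75 n + 9)]. *)
Definition cert {R : comNzRingType} (n y : R) : R :=
  48 * y ^+ 2 * (1 - y ^+ 2)
  + n * (192 * y + 288 * y ^+ 2 - 240 * y ^+ 3 - 144 * y ^+ 4)
  + n ^+ 2 * (208 + 1152 * y + 144 * y ^+ 2 - 720 * y ^+ 3)
  + n ^+ 3 * (1248 + 1968 * y - 912 * y ^+ 2)
  + n ^+ 4 * (2400 + 528 * y) + 1376 * n ^+ 5.

Definition wzterm {R : comNzRingType} (c : nat -> R) (y : R) (n : nat) : R :=
  c n * (poch (1 - y) n * poch y n ^+ 3 * poch y n.*2 * cert n%:R y).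

Definition wzsum {R : comNzRingType} (c : nat -> R) (N : nat) (y : R) : R :=
  \sum_(n < N) wzterm c y n.

(** The ratio of consecutive [c n] with denominators cleared: it makes sense in every commutative
    ring, so it transfers from [rat] to constant polynomials. *)
Definition wzrec {R : comNzRingType} (c : nat -> R) : Prop :=
  forall n, c n.+1 * (8 * n.+1%:R ^+ 5 * (n.*2.+3)%:R ^+ 3)
            = - 3 * (3 * n%:R + 1) * (3 * n%:R + 2) * c n.

(** Telescoping in [n]: the right-hand side is the WZ mate, whose increment in [n] equals the
    difference in [y] of the new term. The recurrence turns the previous mate into a multiple of
    [c n.+1], after which only a polynomial identity remains. *)
Lemma wzsum_shift (R : comNzRingType) (c : nat -> R) (y : R) n :
  wzrec c ->
  wzsum c n.+1 (y + 1) - wzsum c n.+1 y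
  = - 48 * (3 * n%:R + 1) * (3 * n%:R + 2) * c n
    * (poch (1 - y) n * poch (y + 1) n ^+ 3 * poch y n.+1.*2
       * (n%:R + 1 + 2 * y)).
Proof.
move=> crec; elim: n => [|n IHn].
  by rewrite /wzsum !big_ord1 /wzterm /cert doubleS double0 /= !pochS !poch0; ring.
rewrite /wzsum big_ord_recr /= [X in _ - X]big_ord_recr /= -!/(wzsum _ _ _).
set a := wzsum _ _ _ in IHn *; set b := wzsum _ _ y in IHn *.
have -> : a = - 48 * (3 * n%:R + 1) * (3 * n%:R + 2) * c n
    * (poch (1 - y) n * poch (y + 1) n ^+ 3 * poch y n.+1.*2
       * (n%:R + 1 + 2 * y)) + b by rewrite -IHn subrK.
have {}crec : - 48 * (3 * n%:R + 1) * (3 * n%:R + 2) * c n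
  = 128 * n.+1%:R ^+ 5 * (n.*2.+3)%:R ^+ 3 * c n.+1.
  transitivity (16 * (- 3 * (3 * n%:R + 1) * (3 * n%:R + 2) * c n)).
    by ring.
  by rewrite -crec; ring.
rewrite crec /wzterm.
have e1 : poch (1 - (y + 1)) n.+1 = - y * poch (1 - y) n.
  by rewrite poch_recl; congr (_ * poch _ _); ring.
have e2 : y * poch (y + 1) n.+1.*2 = poch y n.+1.*2 * (y + n.+1.*2%:R).
  exact: poch_shift.
have e3 : poch (y + 1) n.+1 = poch (y + 1) n * (y + 1 + n%:R) by rewrite pochS.
have e4 : poch (1 - y) n.+1 = poch (1 - y) n * (1 - y + n%:R) by rewrite pochS.
have e5 : poch y n.+1 = y * poch (y + 1) n by rewrite poch_recl.
have e6 : poch y n.+2.*2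
        = poch y n.+1.*2 * (y + n.+1.*2%:R) * (y + n.+1.*2.+1%:R).
  by rewrite doubleS !pochS.
(* The factor [- y] released by [e1] is absorbed through [e2], so no division by [y] is needed. *)
have {e1 e2}e12 : poch (1 - (y + 1)) n.+1 * poch (y + 1) n.+1.*2
   = - (poch (1 - y) n * (poch y n.+1.*2 * (y + n.+1.*2%:R))).
  by rewrite e1 -e2; ring.
have -> : c n.+1 * (poch (1 - (y + 1)) n.+1 * poch (y + 1) n.+1 ^+ 3 *
    poch (y + 1) n.+1.*2 * cert n.+1%:R (y + 1)) =
   c n.+1 * ((poch (1 - (y + 1)) n.+1 * poch (y + 1) n.+1.*2) *
      poch (y + 1) n.+1 ^+ 3 * cert n.+1%:R (y + 1)) by ring.
rewrite e12 e3 e4 e5 e6 -!mul2n /cert.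
move: (poch (1 - y) n) (poch (y + 1) n) (poch y _) (c _) => u v w d.
ring.
Qed.

(** * The ring of [p]-integral rationals, and interpolation over it *)

Definition plocal (p : nat) : {pred rat} := fun x => p_integral p x.

(** The reduced denominator of [x] divides any [b] that clears it, because it is coprime to the
    numerator. *)
Lemma plocal_frac (p b : nat) (a : int) (x : rat) :
  coprime b p -> x * b%:R = a%:~R -> x \in plocal p.
Proof.
move=> cbp xb; rewrite unfold_in /p_integral; apply: coprime_dvdl cbp.
have e : numq x * b = a * denq x.
  apply: (@intr_inj rat); rewrite !rmorphM /= numqE -xb -!pmulrn; ring.
rewrite -(@Gauss_dvdr _ `|numq x|%N); last by rewrite coprime_sym coprime_num_den.
by rewrite -[b]absz_nat -abszM e abszM dvdn_mull.
Qed.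

Lemma plocal_subring p : GRing.subring_closed (plocal p).
Proof.
have denE (x : rat) : x * `|denq x|%N%:R = (numq x)%:~R.
  by rewrite numqE pmulrn absz_denq.
split=> [|x y xp yp|x y xp yp].
- by apply: (@plocal_frac p 1 1); rewrite ?coprime1n ?mulr1.
- apply: (@plocal_frac p (`|denq x| * `|denq y|)%N
    (numq x * `|denq y|%N - numq y * `|denq x|%N)).
    by rewrite coprimeMl; apply/andP; split.
  rewrite natrM rmorphB !rmorphM /= -!denE -!pmulrn; ring.
- apply: (@plocal_frac p (`|denq x| * `|denq y|)%N (numq x * numq y)).
    by rewrite coprimeMl; apply/andP; split.
  rewrite natrM rmorphM /= -!denE; ring.
Qed.

HB.instance Definition _ p :=
  GRing.isSubringClosed.Build rat (plocal p) (plocal_subring p).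

Lemma plocalV (p b : nat) : coprime b p -> b%:R^-1 \in plocal p.
Proof.
have [->|b0] := posnP b => [_|cbp]; first by rewrite invr0 rpred0.
by apply: (plocal_frac p b 1) => //; rewrite mulVf // pnatr_eq0 -lt0n.
Qed.

(** With an explicit cofactor, a congruence reduces to exhibiting a witness and checking a ring
    identity. *)
Definition pideal (p k : nat) (x : rat) : Prop :=
  exists2 e, e \in plocal p & x = p%:R ^+ k * e.

Lemma rat_congrP (p k : nat) (a b : rat) :
  (0 < p)%N -> pideal p k (a - b) -> rat_congr p k a b.
Proof.
rewrite /rat_congr natrX => p0 [e ep ->]; rewrite mulrAC divff ?mul1r //.
by rewrite expf_neq0 // pnatr_eq0 -lt0n.
Qed.

Ltac ploc := repeat lazymatch goal with
  | |- is_true (_ \in _) => first [assumption | lazymatch goal with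
    | |- is_true (_ + _ \in _) => apply: rpredD
    | |- is_true (- _ \in _) => rewrite rpredN
    | |- is_true (_ * _ \in _) => apply: rpredM
    | |- is_true (_ ^+ _ \in _) => apply: rpredX
    | |- is_true (0 \in _) => exact: rpred0
    | |- is_true (1 \in _) => exact: rpred1
    | |- is_true (_%:R \in _) => exact: rpred_nat
    | |- is_true (_.[_] \in _) => apply: rpred_horner
    end]
  end.

(* [P - f] vanishes to order [4] at [0], so its value at [p] determines its value at
   [p / 2] up to the higher coefficients, which are those of [M] and [W / p ^ 2]. *)
Lemma pideal_interpolation (p : nat) (M W f : {poly rat}) :
  odd p -> M \is a polyOver (plocal p) -> W \is a polyOver (plocal p) ->
  (size f <= 5)%N ->
  let P := M + p%:R ^- 2 *: ('X * W) in
  'X^4 %| P - f -> P.[p%:R] = 0 ->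
  pideal p 5 (P.[p%:R / 2] - (f.[p%:R / 2] - f.[p%:R] / 16
     - p%:R ^+ 3 * W`_4 / 32 - 3 / 64 * p%:R ^+ 4 * W`_5)).
Proof.
move=> podd Mp Wp szf P X4 P0.
have pn0 : p%:R != 0 :> rat by rewrite pnatr_eq0 -lt0n odd_gt0.
have hp : 2^-1 \in plocal p by rewrite plocalV // coprime2n.
have [Q PfQ] : exists Q, P - f = Q * 'X^4.
  by exists ((P - f) %/ 'X^4); rewrite divpK.
have QE i : Q`_i.+1 = M`_(i + 5) + p%:R ^- 2 * W`_(i + 4).
  have -> : Q`_i.+1 = (Q * 'X^4)`_(i + 5).
    by rewrite -addSnnS coefMXn addnK ltnNge leq_addl.
  rewrite -PfQ !coefB coefD coefZ coefXM [f`__]nth_default ?subr0; last first.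
    by rewrite (leq_trans szf) // leq_addl.
  by rewrite -[(i + 5)%N]/(i + 4.+1)%N addnS.
(* By [QE] the denominators in the tail of [Q] are at most [p ^ 2], so this rescaled tail is
   integral. *)
pose R := p%:R ^+ 2 *: drop_poly 3 Q.
have Rp : R \is a polyOver (plocal p).
  apply/polyOverP => i; rewrite coefZ coef_drop_poly addnS QE mulrDr mulrA.
  rewrite divff ?expf_neq0 // mul1r rpredD ?rpredM ?rpredX ?rpred_nat //;
    exact/polyOverP.
have QR a : Q.[a] = Q`_0 + Q`_1 * a + Q`_2 * a ^+ 2 + p%:R ^- 2 * a ^+ 3 * R.[a].
  rewrite -{1}[Q](poly_take_drop 3) hornerD hornerM hornerXn.
  rewrite (@horner_coef_wide _ 3) ?size_take_poly // !big_ord_recr big_ord0 /=.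
  rewrite !coef_take_poly /= /R hornerZ; field; exact: pn0.
have Ph a : P.[a] = f.[a] + Q.[a] * a ^+ 4.
  by rewrite -hornerXn -hornerM -PfQ -hornerD addrC subrK.
have Rap a : a \in plocal p -> R.[a] \in plocal p.
  by move=> ap; rewrite (rpred_horner Rp).
have pp : p%:R \in plocal p by rewrite rpred_nat.
have fp : f.[p%:R] = - (Q.[p%:R] * p%:R ^+ 4).
  by apply/eqP; rewrite -addr_eq0 -Ph P0.
(* Since [f(p) = - p^4 Q(p)], the difference [P(p/2) - f(p/2) + f(p)/16] is
   [p^4 (Q(p/2) - Q(p)) / 16]. Here [Q_0] cancels, [Q_1] and [Q_2] give the terms in [W_4], [W_5],
   [M_5] and [M_6], and the tail gives the terms in [R]. *)
exists ((- M`_5 / 32 - 3 / 64 * p%:R * M`_6)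
        + (R.[p%:R / 2] / 8 - R.[p%:R]) / 16).
  have h4 : 16^-1 \in plocal p.
    by rewrite (_ : 16^-1 = 2^-1 ^+ 4) ?rpredX //; field.
  have h3 : 8^-1 \in plocal p.
    by rewrite (_ : 8^-1 = 2^-1 ^+ 3) ?rpredX //; field.
  have h5 : 32^-1 \in plocal p.
    by rewrite (_ : 32^-1 = 2^-1 ^+ 5) ?rpredX //; field.
  have h6 : 64^-1 \in plocal p.
    by rewrite (_ : 64^-1 = 2^-1 ^+ 6) ?rpredX //; field.
  have M5 : M`_5 \in plocal p by apply/polyOverP.
  have M6 : M`_6 \in plocal p by apply/polyOverP.
  by ploc.
rewrite Ph fp !QR !QE.
move: (f.[_]) (Q`_0) (M`_(0 + 5)) (M`_(1 + 5)) (W`_(0 + 4)) (W`_(1 + 4))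
  (R.[_]) (R.[_]) pn0.
move: (p%:R) => /=; clear=> w fx q m5 m6 w4 w5 r1 r2 w0.
by field; exact: w0.
Qed.

(** * The coefficients [c_n], the zeros of the sum, and its value at [1/2] *)

Definition wzcoef (n : nat) : rat :=
  (-1) ^+ n * (3 * n)`!%:R / (n`!%:R ^+ 3 * (n.*2.+1)`!%:R ^+ 3).

Lemma fact_neq0 (R : numDomainType) n : n`!%:R != 0 :> R.
Proof. by rewrite pnatr_eq0 -lt0n fact_gt0. Qed.

Lemma wzcoef_rec : wzrec wzcoef.
Proof.
move=> n; rewrite /wzcoef exprS.
have -> : (3 * n.+1)`! = ((3 * n).+3 * ((3 * n).+2 * ((3 * n).+1 * (3 * n)`!)))%N.
  by rewrite mulnS !factS.
rewrite doubleS !factS !natrM -!mul2n.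
have n1 := fact_neq0 rat n; have n2 := fact_neq0 rat (2 * n).
move: n1 n2; set u := n`!%:R; set v := (2 * n)`!%:R; set w := (3 * n)`!%:R.
set s := (-1) ^+ n.
move: u v w s => u v w s n1 n2.
have n0 : 0 <= n%:R :> rat by rewrite ler0n.
field; rewrite n1 n2 /=.
by apply/and4P; split; apply: lt0r_neq0; lra.
Qed.

Lemma wzrec_rmorph (R S : comNzRingType) (f : {rmorphism R -> S}) c :
  wzrec c -> wzrec (f \o c).
Proof.
move=> crec n /=; have := congr1 f (crec n).
by rewrite !(rmorph_nat, rmorphXn, rmorph1, rmorphN, rmorphM, rmorphD).
Qed.

Lemma rmorph_cert (R S : comNzRingType) (f : {rmorphism R -> S}) n y :
  f (cert n y) = cert (f n) (f y).
Proof.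
by rewrite /cert !(rmorph_nat, rmorphXn, rmorph1, rmorphN, rmorphM, rmorphD).
Qed.

Lemma rmorph_wzterm (R S : comNzRingType) (f : {rmorphism R -> S}) c y n :
  f (wzterm c y n) = wzterm (f \o c) (f y) n.
Proof.
rewrite /wzterm !(rmorphXn, rmorphM) /= !rmorph_poch rmorph_cert.
by rewrite rmorphB rmorph1 rmorph_nat.
Qed.

Lemma rmorph_wzsum (R S : comNzRingType) (f : {rmorphism R -> S}) c N y :
  f (wzsum c N y) = wzsum (f \o c) N (f y).
Proof.
by rewrite /wzsum rmorph_sum; apply: eq_bigr => n _; rewrite rmorph_wzterm.
Qed.

(** At [0] every term vanishes. Each shift from [j] to [j + 1] with [j <= h] adds zero: the mate
    contains [poch 0 h.+1.*2] for [j = 0] and [poch (1 - j) h] otherwise. *)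
Lemma wzsum_nat (R : comNzRingType) (c : nat -> R) (h j : nat) :
  wzrec c -> (j <= h.+1)%N -> wzsum c h.+1 j%:R = 0.
Proof.
move=> crec; elim: j => [_|j IHj jh].
  rewrite /wzsum big1 // => -[[|n] ?] _; rewrite /wzterm /= ?poch_recl /cert; ring.
have := wzsum_shift _ _ j%:R h crec.
rewrite IHj ?subr0 1?ltnW // [j%:R + 1]natr1 => ->.
case: j jh {IHj} => [|j] jh.
  by rewrite doubleS poch_recl; ring.
suff -> : poch (1 - j.+1%:R) h = 0 :> R by ring.
have jh' : (j < h)%N by [].
by rewrite /poch (bigD1 (Ordinal jh')) //= -natr1; ring.
Qed.

Lemma dvdp_poch (y : {poly rat}) (i n : nat) :
  (i < n)%N -> y + i%:R = 'X -> 'X %| poch y n.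
Proof.
by move=> lin yi; rewrite /poch (bigD1 (Ordinal lin)) //= yi dvdp_mulr.
Qed.

(** For [j = 0] the polynomial is the term [n = 0], and the later terms carry
    [poch 'X n ^+ 3 * poch 'X n.*2]. Each shift by [-1] subtracts a mate in which the cubed product
    and the long one both contain the factor ['X]. *)
Lemma wzsum_dvdX4 (c : nat -> {poly rat}) (h j : nat) :
  wzrec c -> c 0 = 1 -> (j <= h)%N ->
  'X^4 %| wzsum c h.+1 ('X - j%:R)
          - (48 * 'X^2 - 48 * 'X^4).
Proof.
move=> crec c0.
have X4 (u v w t : {poly rat}) : 'X %| u -> 'X %| v -> 'X^4 %| w * (u ^+ 3 * v) * t.
  move=> Xu Xv; rewrite dvdp_mulr // dvdp_mull // (exprSr 'X 3).
  by rewrite dvdp_mul // dvdp_exp2r.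
elim: j => [_|j IHj jh].
  rewrite subr0 /wzsum big_ord_recl.
  have -> : wzterm c 'X (@ord0 h) = 48 * 'X^2 - 48 * 'X^4.
    by rewrite /wzterm /cert /= !poch0 c0; ring.
  rewrite addrAC subrr add0r; apply: (big_ind (fun u => 'X^4 %| u)) => [|u v|i _].
  - exact: dvdp0.
  - exact: dvdp_add.
  rewrite /wzterm /=.
  set a := c _; set b := poch _ _; set t := cert _ _.
  set u := poch _ _; set v := poch _ _.
  have -> : a * (b * u ^+ 3 * v * t) = (a * b) * (u ^+ 3 * v) * t by ring.
  by apply: X4; apply: (@dvdp_poch _ 0); rewrite ?addr0 ?doubleS.
have := wzsum_shift _ _ ('X - j.+1%:R) h crec.
have -> : 'X - j.+1%:R + 1 = 'X - j%:R :> {poly rat} by rewrite -natr1; ring.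
set a := wzsum _ _ _; set b := wzsum _ _ _ => e.
have -> : b = a - (a - b) by rewrite opprB addrC subrK.
rewrite addrAC dvdp_sub //; first exact/IHj/ltnW.
rewrite e; set u := poch _ _; set v := poch ('X - j%:R) _; set w := poch _ _.
set d := _ * c h; set t := _ + _ * _.
have -> : d * (u * v ^+ 3 * w * t) = (d * u) * (v ^+ 3 * w) * t by ring.
apply: X4; first by apply: (@dvdp_poch _ j); rewrite ?subrK.
by apply: (@dvdp_poch _ j.+1); rewrite ?subrK // doubleS; lia.
Qed.

Lemma poch_half n : poch 2^-1 n = (n.*2)`!%:R / (4 ^+ n * n`!%:R) :> rat.
Proof.
elim: n => [|n IHn]; first by rewrite poch0 !fact0 divr1.
rewrite pochS IHn doubleS !factS !natrM exprS.
have n1 := fact_neq0 rat n.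
have f4 : 4 ^+ n != 0 :> rat by rewrite expf_neq0.
rewrite -mul2n; field; rewrite n1 f4 /= andbT.
have n0 : 0 <= n%:R :> rat by rewrite ler0n.
by apply: lt0r_neq0; lra.
Qed.

Lemma wzsum_half N :
  wzsum wzcoef N 2^-1 =
  \sum_(0 <= k < N)
     ((-1) ^+ k * (172 * k%:R ^+ 2 + 75 * k%:R + 9) / 2 ^+ (12 * k)
      * ('C(k.*2, k) ^ 3 * 'C(3 * k, k) * 'C(4 * k, k.*2))%:R).
Proof.
rewrite big_mkord /wzsum; apply: eq_bigr => -[k ?] _ /=.
rewrite /wzterm /wzcoef.
have -> : 1 - 2^-1 = 2^-1 :> rat by field.
rewrite !poch_half.
have binE m n : (n <= m)%N -> 'C(m, n)%:R = m`!%:R / (n`!%:R * (m - n)`!%:R) :> rat.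
  move=> nm; rewrite -(bin_fact nm) !natrM mulfK //.
  by rewrite mulf_neq0 // fact_neq0.
have -> a b c : (a ^ 3 * b * c)%:R = a%:R ^+ 3 * b%:R * c%:R :> rat.
  by rewrite 2!natrM natrX.
rewrite !binE; try lia.
have -> : (k.*2 - k = k)%N by lia.
have -> : (3 * k - k = k.*2)%N by lia.
have -> : (4 * k - k.*2 = k.*2)%N by lia.
have -> : (k.*2.*2 = 4 * k)%N by lia.
(* The powers of [4] from the four factors [poch 2^-1 k] and from [poch 2^-1 k.*2]. *)
have -> : 2 ^+ (12 * k) = (4 ^+ k) ^+ 4 * 4 ^+ k.*2 :> rat.
  by rewrite -!exprM -exprD (_ : 4 = 2 ^+ 2) // -exprM; congr (_ ^+ _); lia.
have -> : 4 ^+ k.*2 = (4 ^+ k) ^+ 2 :> rat by rewrite -exprM muln2.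
(* The cube of [2k + 1] split off here cancels the one in [cert k (1/2)]. *)
rewrite factS natrM.
have n1 := fact_neq0 rat k; have n2 := fact_neq0 rat (k.*2).
have n4 : 4 ^+ k != 0 :> rat by rewrite expf_neq0.
have n5 : (k.*2.+1)%:R != 0 :> rat by rewrite pnatr_eq0.
move: n5; rewrite -natr1 -muln2 natrM muln2.
move: (k`!%:R) ((k.*2)`!%:R) ((3 * k)`!%:R) ((4 * k)`!%:R) (4 ^+ k) ((-1) ^+ k)
  (k%:R) n1 n2 n4 => u v w t s e x n1 n2 n4 n5.
rewrite /cert; field; rewrite n1 n2 n4 /=.
by apply: contra_neq n5 => <-; ring.
Qed.

(** * The product [D] and the last term of the sum *)

Lemma poch_addn (R : comNzRingType) (x : R) m n :
  poch x (m + n) = poch x m * poch (x + m%:R) n.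
Proof.
elim: n => [|n IHn]; first by rewrite addn0 poch0 mulr1.
by rewrite addnS !pochS IHn natrD mulrA addrA.
Qed.

Lemma poch1 (R : comNzRingType) n : poch 1 n = n`!%:R :> R.
Proof.
by elim: n => [|n IHn]; rewrite ?poch0 // pochS IHn factS natrM -natr1; ring.
Qed.

Lemma natr_double1 (R : comNzRingType) (h : nat) :
  h.*2.+1%:R = 2 * h%:R + 1 :> R.
Proof. by rewrite -natr1 -mul2n natrM. Qed.

(* With [r i = 1 / (i + 1)] this is [prod_(1 <= i <= n) (1 - x / i)]. *)
Definition eprod {R : comNzRingType} (r : nat -> R) (n : nat) (x : R) : R :=
  \prod_(i < n) (1 - r i * x).

(** Inverses as data, so that [eprod] serves both [rat] and [{poly rat}], where they are constant
    polynomials. *)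
Definition natinv {R : comNzRingType} (r : nat -> R) : Prop :=
  forall i, r i * i.+1%:R = 1.

Lemma eprod0 (R : comNzRingType) (r : nat -> R) x : eprod r 0 x = 1.
Proof. by rewrite /eprod big_ord0. Qed.

Lemma eprodS (R : comNzRingType) (r : nat -> R) n x :
  eprod r n.+1 x = eprod r n x * (1 - r n * x).
Proof. by rewrite /eprod big_ord_recr. Qed.

Lemma poch_subn (R : comNzRingType) (r : nat -> R) n x : natinv r ->
  poch (x - n%:R) n = (-1) ^+ n * n`!%:R * eprod r n x.
Proof.
move=> rK; elim: n => [|n IHn]; first by rewrite poch0 eprod0 fact0 ?expr0 !mulr1.
rewrite poch_recl eprodS factS natrM exprS.
have -> : x - n.+1%:R + 1 = x - n%:R by rewrite -natr1; ring.
rewrite IHn; transitivity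
  ((-1) ^+ n * n`!%:R * eprod r n x * (r n * n.+1%:R * x - n.+1%:R)).
  by rewrite rK; ring.
by ring.
Qed.

Lemma poch_add1 (R : comNzRingType) (r : nat -> R) n x : natinv r ->
  poch (x + 1) n = n`!%:R * eprod r n (- x).
Proof.
move=> rK; elim: n => [|n IHn]; first by rewrite poch0 eprod0 fact0 ?expr0 !mulr1.
rewrite pochS eprodS factS natrM IHn; transitivity
  (n`!%:R * eprod r n (- x) * (n.+1%:R + r n * n.+1%:R * x)).
  by rewrite rK -natr1; ring.
by ring.
Qed.

Lemma rmorph_eprod (R S : comNzRingType) (f : {rmorphism R -> S}) r n x :
  f (eprod r n x) = eprod (f \o r) n (f x).
Proof.
rewrite /eprod rmorph_prod; apply: eq_bigr => i _ /=.
by rewrite rmorphB rmorphM rmorph1.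
Qed.

Definition invn (i : nat) : rat := i.+1%:R^-1.

Lemma invnK : natinv invn.
Proof. by move=> i; rewrite /invn mulVf // pnatr_eq0. Qed.

Lemma invnK_poly : natinv (polyC \o invn).
Proof. by move=> i; rewrite -polyC_natr -rmorphM /= invnK. Qed.

(** The upper half [(h+1)...(2h)] of the factorial is [poch (p - h) h] with [p = 2h+1]. *)
Lemma fact_eprod_subn h :
  (h.*2)`!%:R = (-1) ^+ h * h`!%:R ^+ 2 * eprod invn h h.*2.+1%:R.
Proof.
rewrite -poch1 -addnn poch_addn poch1.
have -> : 1 + h%:R = (h + h).+1%:R - h%:R :> rat by rewrite -natr1 natrD; ring.
by rewrite (poch_subn _ _ _ _ invnK); ring.
Qed.

Lemma fact_eprod_add k n :
  ((n + k)`!)%:R = n`!%:R * k`!%:R * eprod invn k (- n%:R).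
Proof.
by rewrite -[LHS]poch1 poch_addn poch1 addrC (poch_add1 _ _ _ _ invnK) mulrA.
Qed.

(** Both sides come from [poch 2^-1 h]: once through [1/2 = p/2 - h], which gives [D(p/2)], and once
    through [(2h)!], which gives [D(p)]. *)
Lemma eprod_half h :
  eprod invn h h.*2.+1%:R = 2 ^+ h.*2 * eprod invn h (h.*2.+1%:R / 2).
Proof.
have e1 := poch_half h.
have e2 : 2^-1 = h.*2.+1%:R / 2 - h%:R :> rat.
  by rewrite natr_double1; field.
rewrite {1}e2 (poch_subn _ _ _ _ invnK) fact_eprod_subn in e1.
have h0 := fact_neq0 rat h.
have s0 : (-1) ^+ h != 0 :> rat by rewrite expf_neq0 // oppr_eq0 oner_eq0.
have f0 : 4 ^+ h != 0 :> rat by rewrite expf_neq0.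
have -> : 2 ^+ h.*2 = 4 ^+ h :> rat.
  by rewrite -mul2n exprM; congr (_ ^+ _).
move: (eprod _ _ _) (eprod _ _ _) e1 => a b e1.
have s0h : (-1) ^+ h * h`!%:R != 0 :> rat by rewrite mulf_neq0.
apply: (mulfI s0h); rewrite mulrCA e1; field.
by rewrite f0 h0.
Qed.

(** At [y = 'X - h], [poch y h] gives [D(X)] three times and once more as the lower half of
    [poch y h.*2]; its upper half gives ['X] times the factor with [h.-1], and [poch (1 - y) h]
    gives [D(p - X)]. *)
Definition vprod (h : nat) : {poly rat} :=
  eprod (polyC \o invn) h 'X ^+ 4 * eprod (polyC \o invn) h (h.*2.+1%:R - 'X)
  * eprod (polyC \o invn) h.-1 (- 'X).

(** This is [(-1)^h p^2 c_h h!^5 (h-1)!]. *)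
Definition vscale (h : nat) : rat :=
  eprod invn h.-1 (- h.*2.+1%:R) / (h%:R * eprod invn h h.*2.+1%:R) ^+ 2.

Lemma wzterm_last (k : nat) (h := k.+1) (p := h.*2.+1) :
  wzterm (polyC \o wzcoef) ('X - h%:R) h
  = p%:R ^- 2 *: ('X * (vscale h *: vprod h * cert h%:R ('X - h%:R))).
Proof.
rewrite /wzterm.
have -> : 1 - ('X - h%:R) = (p%:R - 'X) - h%:R :> {poly rat}.
  by rewrite /p natr_double1; ring.
rewrite -addnn poch_addn subrK {4}/h (poch_recl _ 'X k).
rewrite !(poch_subn _ _ _ _ invnK_poly) (poch_add1 _ _ _ _ invnK_poly) /vprod /=.
set A := cert _ _; set D := eprod _ _ 'X; set D1 := eprod _ _ _.
set D2 := eprod _ _ _.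
have e : wzcoef h * (h`!%:R ^+ 5 * k`!%:R) = (-1) ^+ h * (p%:R ^- 2 * vscale h).
  rewrite /wzcoef /vscale.
  (* Hence [(3h)!] contributes one factor [p] against the three in [p!^3]: this is the source of
     [p^-2]. *)
  have -> : (3 * h = p + k)%N by rewrite /p /h; lia.
  rewrite fact_eprod_add.
  have -> : p`!%:R = p%:R * ((-1) ^+ h * h`!%:R ^+ 2 * eprod invn h p%:R) :> rat.
    by rewrite factS natrM fact_eprod_subn.
  rewrite -/p -[h%:R in X in _ = X]/(k.+1%:R : rat).
  have dn0 : eprod invn h p%:R != 0.
    have := fact_neq0 rat h.*2; rewrite fact_eprod_subn.
    by apply: contra_neq => ->; rewrite mulr0.
  have s2 : ((-1) ^+ h) ^+ 2 = 1 :> rat by rewrite -exprM mulnC exprM sqrrN !expr1n.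
  have -> : h`!%:R = k.+1%:R * k`!%:R :> rat by rewrite factS natrM.
  have pn0 : p%:R != 0 :> rat by rewrite pnatr_eq0.
  have kn0 := fact_neq0 rat k.
  have k1n0 : k.+1%:R != 0 :> rat by rewrite pnatr_eq0.
  have sn0 : (-1) ^+ h != 0 :> rat by rewrite expf_neq0 // oppr_eq0 oner_eq0.
  rewrite -[h.-1]/k; set b := eprod invn k _.
  move: (eprod invn h p%:R) dn0 => a a0; move: b => b.
  move: (k.+1%:R) (k`!%:R) (p%:R) ((-1) ^+ h) s2 pn0 kn0 k1n0 sn0
    => c d f s s2 f0 d0 c0 s0.
  field: s2.
  by rewrite a0 f0 d0 c0 s0.
rewrite -!mul_polyC -[(k.+1)`!]/(h`!) -[k.+1]/h.
have {}e : (wzcoef h)%:P * (h`!%:R ^+ 5 * k`!%:R)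
  = (-1) ^+ h * ((p%:R ^- 2)%:P * (vscale h)%:P) :> {poly rat}.
  have := congr1 (@polyC rat) e.
  by rewrite !(rmorph_nat, rmorphXn, rmorph1, rmorphN, rmorphM) /= => <-.
(* Five signs come from the rising factorials and one from [c_h]. *)
have s6 : ((-1) ^+ h) ^+ 6 = 1 :> {poly rat}.
  by rewrite -exprM mulnC exprM -[6%N]/(2 * 3)%N exprM sqrrN !expr1n.
transitivity ((wzcoef h)%:P * (h`!%:R ^+ 5 * k`!%:R) * ((-1) ^+ h) ^+ 5
  * (D1 * D ^+ 4 * ('X * D2) * A)).
  by ring.
rewrite e; transitivity ((p%:R ^- 2)%:P * (vscale h)%:P * ((-1) ^+ h) ^+ 6
  * (D1 * D ^+ 4 * ('X * D2) * A)).
  by ring.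
by rewrite s6; ring.
Qed.

(** * Dual numbers and the final congruence in [H] and [E] *)

(* [x = a + p b] modulo [p ^ 2]: arithmetic of dual numbers. *)
Definition apx (p : nat) (x a b : rat) : Prop :=
  [/\ a \in plocal p, b \in plocal p
    & exists2 e, e \in plocal p & x = a + p%:R * b + p%:R ^+ 2 * e].

Lemma apxC p c : c \in plocal p -> apx p c c 0.
Proof. by move=> cp; split; rewrite ?rpred0 //; exists 0; [ploc | ring]. Qed.

Lemma apxp p : apx p p%:R 0 1.
Proof. by split; rewrite ?rpred0 ?rpred1 //; exists 0; [ploc | ring]. Qed.

Lemma apx_local p x a b : apx p x a b -> x \in plocal p.
Proof. by case=> ap bp [e ep ->]; ploc. Qed.

Lemma apxD p x a b y c d :
  apx p x a b -> apx p y c d -> apx p (x + y) (a + c) (b + d).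
Proof.
case=> ap bp [e ep ->] [cp dp [f fp ->]].
by split; ploc; exists (e + f); [ploc | ring].
Qed.

Lemma apxN p x a b : apx p x a b -> apx p (- x) (- a) (- b).
Proof. by case=> ap bp [e ep ->]; split; ploc; exists (- e); [ploc | ring]. Qed.

Lemma apxM p x a b y c d :
  apx p x a b -> apx p y c d -> apx p (x * y) (a * c) (a * d + b * c).
Proof.
case=> ap bp [e ep ->] [cp dp [f fp ->]].
split; ploc; exists (a * f + b * d + e * c + p%:R * (b * f + e * d)
  + p%:R ^+ 2 * e * f); [by ploc | by ring].
Qed.

Lemma apxX2 p x a b : apx p x a b -> apx p (x ^+ 2) (a ^+ 2) (2 * a * b).
Proof.
move=> xab; have := apxM _ _ _ _ _ _ _ xab xab.
by rewrite (_ : a * b + b * a = 2 * a * b) //; ring.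
Qed.

Ltac apx_solve := repeat lazymatch goal with
  | |- apx _ ?x _ _ => first [is_var x; eassumption | lazymatch goal with
    | |- apx _ (_ + _) _ _ => eapply apxD
    | |- apx _ (- _) _ _ => eapply apxN
    | |- apx _ (_ * _) _ _ => eapply apxM
    | |- apx _ (_ ^+ 2) _ _ => eapply apxX2
    | |- apx ?p (?p%:R) _ _ => apply: apxp
    | _ => apply: apxC; try solve [ploc]
    end]
  end.

(* [d0], [d1], [d2] are the first coefficients of [D(p - z)], [r = 1/h], and
   [v * N_i] are those of the cofactor of the certificate in [W]. *)
Lemma wz_congruence (p : nat) (H E q r d0 d1 d2 m g c : rat) :
  2^-1 \in plocal p -> H \in plocal p -> E \in plocal p -> r \in plocal p ->
  g \in plocal p -> r * (p%:R - 1) = 2 -> g * d0 = 1 ->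
  apx p d0 1 (- H) -> apx p d1 H (- 2 * E) -> apx p d2 E c ->
  apx p m 1 (H - r) -> apx p q (- H / 2) (3 * E / 4 - H ^+ 2 / 4) ->
  pideal p 1 (3 * (H ^+ 2 - 2 * E)) ->
  let v := m * (r * g) ^+ 2 in
  let N1 := d1 + d0 * (- 4 * H + (H - r)) in
  let N2 := d2 + d1 * (- 4 * H + (H - r)) + d0 * (6 * H ^+ 2 + 4 * E
              - 4 * H * (H - r) + (E - r * (H - r))) in
  let a := 24 * (1 - 3 * p%:R) in
  let b := - 12 * (1 - 4 * p%:R + 3 * p%:R ^+ 2) in
  pideal p 2 ((a * (v * d0) + b * (v * N1)) / 32
    + 3 * p%:R / 64 * (a * (v * N1) + b * (v * N2)) + 6 * q - 9 * p%:R * q ^+ 2).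
Proof.
move=> hp Hp Ep rp gp rE gE ad0 ad1 ad2 am aq [t tp tE] v N1 N2 a b.
have h4 : 4^-1 \in plocal p.
  by rewrite (_ : 4^-1 = 2^-1 ^+ 2) ?rpredX //; field.
have h5 : 32^-1 \in plocal p.
  by rewrite (_ : 32^-1 = 2^-1 ^+ 5) ?rpredX //; field.
have h6 : 64^-1 \in plocal p.
  by rewrite (_ : 64^-1 = 2^-1 ^+ 6) ?rpredX //; field.
(* Iterating this fixed-point equation expands [r] to any order in [p]. *)
have rE' : r = - 2 + p%:R * r by rewrite -rE; ring.
have ar : apx p r (- 2) (- 2).
  by split; ploc; exists r; [exact: rp | rewrite {1}rE' {1}rE'; ring].
have {}am : apx p m 1 (H + 2).
  have [_ _ [e ep ->]] := am; split; ploc; exists (e - r); first by ploc.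
  by rewrite [in LHS]rE'; ring.
have ag : apx p g 1 H.
  have [_ _ [e ep d0E]] := ad0; split; ploc.
  exists ((H ^+ 2 - p%:R * H * e - e) * g); first by ploc.
  transitivity (g * d0 * (1 + p%:R * H)
    + p%:R ^+ 2 * ((H ^+ 2 - p%:R * H * e - e) * g)).
    by rewrite d0E; ring.
  by rewrite gE; ring.
(* The two parts are synthesised by [apx_solve]: the constant part vanishes, and the part at [p] is
   the quantity assumed divisible by [p]. *)
have [x [y [axy x0 y0]]] : exists x y, [/\ apx p ((a * (v * d0) + b * (v * N1)) / 32
    + 3 * p%:R / 64 * (a * (v * N1) + b * (v * N2)) + 6 * q - 9 * p%:R * q ^+ 2) x y,
    x = 0 & y = 3 * (H ^+ 2 - 2 * E)].
  rewrite /v /N1 /N2 /a /b; eexists; eexists; split.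
  - apx_solve.
  - by field.
  - by field.
have [_ _ [e ep ->]] := axy.
by exists (t + e); [ploc | rewrite x0 y0 tE; ring].
Qed.

(** * Integrality of the coefficients and products *)

Lemma coprime_small (p i : nat) : prime p -> (0 < i < p)%N -> coprime i p.
Proof.
by move=> pp ip; rewrite coprime_sym prime_coprime // gtnNdvd; case/andP: ip.
Qed.

Lemma coprime_fact (p n : nat) : prime p -> (n < p)%N -> coprime n`! p.
Proof.
move=> pp; elim: n => [|n IHn] np; first by rewrite coprime1n.
by rewrite factS coprimeMl IHn 1?ltnW // coprime_small.
Qed.

Lemma plocal_invn (p i : nat) : prime p -> (i.+1 < p)%N -> invn i \in plocal p.
Proof. by move=> pp ip; rewrite plocalV // coprime_small. Qed.

Lemma plocal_wzcoef (p n : nat) :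
  prime p -> (n.*2.+1 < p)%N -> wzcoef n \in plocal p.
Proof.
move=> pp np; rewrite /wzcoef invfM -!exprVn.
have f1 : n`!%:R^-1 \in plocal p by rewrite plocalV // coprime_fact //; lia.
have f2 : (n.*2.+1)`!%:R^-1 \in plocal p by rewrite plocalV // coprime_fact.
by ploc.
Qed.

Lemma polyOver_poch (p : nat) (y : {poly rat}) n :
  y \is a polyOver (plocal p) -> poch y n \is a polyOver (plocal p).
Proof. by move=> yp; apply: rpred_prod => i _; rewrite rpredD ?rpred_nat. Qed.

Lemma polyOver_cert (p : nat) (n y : {poly rat}) :
  n \is a polyOver (plocal p) -> y \is a polyOver (plocal p) ->
  cert n y \is a polyOver (plocal p).
Proof. by move=> np yp; rewrite /cert; ploc. Qed.

Lemma polyOver_wzsum (p N : nat) (y : {poly rat}) :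
  prime p -> (N.*2 < p)%N -> y \is a polyOver (plocal p) ->
  wzsum (polyC \o wzcoef) N y \is a polyOver (plocal p).
Proof.
move=> pp Np yp; apply: rpred_sum => -[n nN] _; rewrite /wzterm /=.
have cp : (wzcoef n)%:P \is a polyOver (plocal p).
  by rewrite polyOverC plocal_wzcoef //; lia.
have y1 : 1 - y \is a polyOver (plocal p) by ploc.
have n1 : n%:R \is a polyOver (plocal p) by rewrite rpred_nat.
by rewrite !(rpredM, rpredX, polyOver_poch, polyOver_cert).
Qed.

Lemma polyOver_eprod (p n : nat) (y : {poly rat}) :
  prime p -> (n < p)%N -> y \is a polyOver (plocal p) ->
  eprod (polyC \o invn) n y \is a polyOver (plocal p).
Proof.
move=> pp np yp; apply: rpred_prod => -[i lin] _ /=.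
by rewrite rpredB ?rpred1 // rpredM // polyOverC plocal_invn //; lia.
Qed.

Lemma coefM3 (P Q : {poly rat}) :
  [/\ (P * Q)`_0 = P`_0 * Q`_0, (P * Q)`_1 = P`_0 * Q`_1 + P`_1 * Q`_0
    & (P * Q)`_2 = P`_0 * Q`_2 + P`_1 * Q`_1 + P`_2 * Q`_0].
Proof. by split; rewrite coefM !big_ord_recr big_ord0 /= add0r. Qed.

Lemma poly_trunc3 (p : nat) (Q : {poly rat}) : Q \is a polyOver (plocal p) ->
  exists2 R : {poly rat}, R \is a polyOver (plocal p)
    & Q = (Q`_0)%:P + (Q`_1)%:P * 'X + (Q`_2)%:P * ('X * 'X)
          + R * ('X * ('X * 'X)).
Proof.
move=> /polyOverP Qp; exists (drop_poly 3 Q).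
  by apply/polyOverP => i; rewrite coef_drop_poly.
rewrite -{1}[Q](poly_take_drop 3).
have -> : 'X^3 = 'X * ('X * 'X) :> {poly rat} by ring.
congr (_ + _); apply/polyP => i; rewrite coef_take_poly !coefD !coefCM coefC.
have -> : ('X * 'X : {poly rat}) = 'X^2 by ring.
rewrite coefX coefXn; case: i => [|[|[|i]]] /=; ring.
Qed.

(** * Inverse squares modulo [p] *)

Lemma sum_even_odd (R : comNzRingType) (f : nat -> R) n :
  \sum_(0 <= i < n.*2) f i = \sum_(0 <= i < n) (f i.*2 + f i.*2.+1).
Proof.
elim: n => [|n IHn]; first by rewrite !big_geq.
by rewrite doubleS !big_nat_recr //= IHn addrA.
Qed.

(** Let [S] be the sum. Reflecting [i] to [p - i], the sum over [1..2h] is [2 S] modulo [p]. Its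
    even part is [S/4], and its odd part reflects to the even one, so [2 S = S/2]. Keeping the
    factor [3] covers [p = 3]. *)
Lemma sum_invn_sqr (h : nat) (p := h.*2.+1) : prime p ->
  pideal p 1 (3 * \sum_(0 <= i < h) invn i ^+ 2).
Proof.
move=> pp; pose a i := invn i ^+ 2; set S := \sum_(_ <= _ < _) _.
have refl i : (i < h.*2)%N -> pideal p 1 (a (h.*2 - i.+1)%N - a i).
  move=> ih; have ap : invn i \in plocal p by rewrite plocal_invn.
  have bp : invn (h.*2 - i.+1) \in plocal p by rewrite plocal_invn //; lia.
  exists (invn i ^+ 2 * invn (h.*2 - i.+1) ^+ 2 * (2 * i.+1%:R - p%:R)).
    by ploc.
  rewrite /a; have := invnK i; have := invnK (h.*2 - i.+1)%N.
  have -> : (h.*2 - i.+1).+1%:R = p%:R - i.+1%:R :> rat.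
    by rewrite -natrB; [congr (_%:R); lia | lia].
  move: (invn i) (invn _) (i.+1%:R) (p%:R) => x y u w e1 e2.
  transitivity (y ^+ 2 * (x * u) ^+ 2 - x ^+ 2 * (y * (w - u)) ^+ 2).
    by rewrite e1 e2; ring.
  by ring.
have sumrefl (g : nat -> nat) : (forall i, (i < h)%N -> (g i < h.*2)%N) ->
    exists2 e, e \in plocal p & \sum_(0 <= i < h) a (h.*2 - (g i).+1)%N
       = \sum_(0 <= i < h) a (g i) + p%:R * e.
  move=> gh; have : pideal p 1 (\sum_(0 <= i < h) (a (h.*2 - (g i).+1)%N - a (g i))).
    rewrite big_nat; apply: (big_ind (pideal p 1)) => [|x y [e ep ->] [f fp ->]|i].
    - by exists 0; [ploc | ring].
    - by exists (e + f); [ploc | ring].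
    - by move=> /andP[_ ih]; apply/refl/gh.
  rewrite sumrB => -[e ep eE]; exists e => //.
  by apply/eqP; rewrite addrC -subr_eq eE expr1.
have lt1 i : (i < h)%N -> (i < h.*2)%N by lia.
have lt2 i : (i < h)%N -> (i.*2.+1 < h.*2)%N by lia.
(* Index [i] stands for [i + 1], so the second choice, [i.*2.+1], runs over the even numbers. *)
have [e1 e1p e1E] := sumrefl id lt1; have [e2 e2p e2E] := sumrefl _ lt2.
have even4 : \sum_(0 <= i < h) a i.*2.+1 = S / 4.
  rewrite mulr_suml; apply: eq_bigr => i _; rewrite /a /invn -doubleS -mul2n natrM.
  by rewrite invfM; move: (i.+1%:R^-1) => y; field.
have T1 : \sum_(0 <= i < h.*2) a i = S + \sum_(0 <= i < h) a (h.*2 - i.+1)%N.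
  rewrite (big_cat_nat _ (n := h)) //=; last by lia.
  congr (_ + _); rewrite big_nat_rev /= -{1}[h]add0n big_addn.
  have -> : (h.*2 - h = h)%N by lia.
  by rewrite !big_nat; apply: eq_bigr => i ?; congr a; lia.
have T2 : \sum_(0 <= i < h.*2) a i
    = \sum_(0 <= i < h) a (h.*2 - i.*2.+2)%N + S / 4.
  rewrite sum_even_odd big_split even4 /=; congr (_ + _).
  by rewrite big_nat_rev /= !big_nat; apply: eq_bigr => i ?; congr a; lia.
rewrite /= e1E in T1; rewrite e2E even4 in T2.
have {}T1 : S + (S + p%:R * e1) = S / 4 + p%:R * e2 + S / 4 by rewrite -T1 -T2.
exists (2 * (e2 - e1)); first by ploc.
by rewrite expr1; move: (p%:R) T1 => w T1; lra.
Qed.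

(** * Low coefficients of the products and of [W] *)

Lemma horner_eprod n (y : {poly rat}) a :
  (eprod (polyC \o invn) n y).[a] = eprod invn n y.[a].
Proof.
rewrite -[LHS]/(horner_eval a _) rmorph_eprod; apply: eq_bigr => i _ /=.
by rewrite /horner_eval hornerC.
Qed.

Lemma eprod_coef0 n (y : {poly rat}) :
  y`_0 = 0 -> (eprod (polyC \o invn) n y)`_0 = 1.
Proof.
rewrite -!horner_coef0 horner_eprod => ->.
by rewrite /eprod big1 // => i _; rewrite mulr0 subr0.
Qed.

Lemma eprod_comp n (y : {poly rat}) :
  eprod (polyC \o invn) n y = eprod (polyC \o invn) n 'X \Po y.
Proof.
rewrite rmorph_eprod /= comp_polyX; apply: eq_bigr => i _ /=.
by rewrite comp_polyC.
Qed.

(** Newton's identity for the second power sum of the [1/i]. *)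
Lemma eprod_coef_sqr n (D := eprod (polyC \o invn) n 'X) :
  D`_1 ^+ 2 - 2 * D`_2 = \sum_(0 <= i < n) invn i ^+ 2.
Proof.
rewrite {}/D; elim: n => [|n IHn].
  by rewrite big_geq // eprod0 !coef1 /=; ring.
rewrite eprodS big_nat_recr //= -IHn; set D := eprod _ _ _ in IHn *.
have D0 : D`_0 = 1 by rewrite eprod_coef0 // coefX.
have [_ -> ->] := coefM3 D (1 - (invn n)%:P * 'X).
rewrite !coefB !coefCM !coef1 !coefX /= D0.
by move: (D`_1) (D`_2) (invn n) => x y z; ring.
Qed.

(** Substitute [p - X] into the expansion of [D] to order [3]. The [p]-part of the last coefficient
    may stay unspecified, since that coefficient enters the final congruence with a factor [p]. *)
Lemma eprod_reflect_coef (p n : nat) (D := eprod (polyC \o invn) n 'X)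
    (D' := eprod (polyC \o invn) n (p%:R - 'X)) :
  prime p -> (n < p)%N ->
  [/\ apx p D'`_0 1 D`_1, apx p D'`_1 (- D`_1) (- 2 * D`_2)
    & exists c, apx p D'`_2 D`_2 c].
Proof.
move=> pp np.
have Dp : D \is a polyOver (plocal p) by rewrite polyOver_eprod // polyOverX.
have Dip i : D`_i \in plocal p by apply/polyOverP.
have [R Rp DE] := poly_trunc3 _ _ Dp.
have D0 : D`_0 = 1 by rewrite eprod_coef0 // coefX.
pose L : {poly rat} := p%:R - 'X.
have Lp : L \is a polyOver (plocal p) by rewrite rpredB ?rpred_nat ?polyOverX.
have [L0 L1 L2] : [/\ L`_0 = p%:R, L`_1 = -1 & L`_2 = 0].
  by rewrite /L -polyC_natr !coefB !coefC !coefX /=; split; ring.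
pose Q := R \Po L.
have Qp i : Q`_i \in plocal p.
  by apply/polyOverP; rewrite polyOver_comp.
have D'E : D' = 1 + (D`_1)%:P * L + (D`_2)%:P * (L * L) + Q * (L * (L * L)).
  rewrite /D' eprod_comp -/D {1}DE !comp_polyD !comp_polyM !comp_polyC !comp_polyX.
  by rewrite D0 polyC1.
have [L20 L21 L22] := coefM3 L L; have [L30 L31 L32] := coefM3 L (L * L).
have [Q0 Q1 Q2] := coefM3 Q (L * (L * L)).
have D1p := Dip 1%N; have D2p := Dip 2%N.
have Q0p := Qp 0%N; have Q1p := Qp 1%N; have Q2p := Qp 2%N.
rewrite D'E !coefD !coefCM !coef1 Q0 Q1 Q2 L30 L31 L32 L20 L21 L22 L0 L1 L2 /=.
clear -D1p D2p Q0p Q1p Q2p.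
move: (D`_1) (D`_2) (Q`_0) (Q`_1) (Q`_2) D1p D2p Q0p Q1p Q2p
  => d1 d2 q0 q1 q2 d1p d2p q0p q1p q2p.
split; last exists (3 * q0).
- by split; ploc; exists (d2 + p%:R * q0); [ploc | ring].
- by split; ploc; exists (- 3 * q0 + p%:R * q1); [ploc | ring].
- by split; ploc; exists (- 3 * q1 + p%:R * q2); [ploc | ring].
Qed.

Lemma eprod_opp_coef n (D := eprod (polyC \o invn) n 'X)
    (D' := eprod (polyC \o invn) n (- 'X)) :
  D'`_1 = - D`_1 /\ D'`_2 = D`_2.
Proof.
rewrite {}/D {}/D'; elim: n => [|n [IH1 IH2]].
  by rewrite !eprod0 !coef1 oppr0.
have D0 : (eprod (polyC \o invn) n 'X)`_0 = 1 by rewrite eprod_coef0 // coefX.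
have D'0 : (eprod (polyC \o invn) n (- 'X))`_0 = 1.
  by rewrite eprod_coef0 // coefN coefX oppr0.
rewrite !eprodS /=; have [_ -> ->] := coefM3 (eprod (polyC \o invn) n 'X) (1 - (invn n)%:P * 'X).
have [_ -> ->] := coefM3 (eprod (polyC \o invn) n (- 'X))
  (1 - (invn n)%:P * - 'X).
rewrite !coefB !coefCM !coefN !coef1 !coefX /= D0 D'0 IH1 IH2.
move: (eprod _ n 'X) => D; move: (D`_1) (D`_2) (invn n) => x y z; split; ring.
Qed.

Lemma eprod_opp_pred_coef k (D := eprod (polyC \o invn) k.+1 'X)
    (D' := eprod (polyC \o invn) k (- 'X)) :
  D'`_1 = - D`_1 - invn k /\ D'`_2 = D`_2 - invn k * (- D`_1 - invn k).
Proof.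
have [e1 e2] := eprod_opp_coef k; rewrite {}/D' {}/D e1 e2 eprodS /=.
have D0 : (eprod (polyC \o invn) k 'X)`_0 = 1 by rewrite eprod_coef0 // coefX.
have [_ -> ->] := coefM3 (eprod (polyC \o invn) k 'X) (1 - (invn k)%:P * 'X).
rewrite !coefB !coefCM !coef1 !coefX /= D0.
move: (eprod _ k 'X) => D; move: (D`_1) (D`_2) (invn k) => x y z; split; ring.
Qed.

Lemma vprod_coef k (h := k.+1) (p := h.*2.+1)
    (D := eprod (polyC \o invn) h 'X) (H := - D`_1) (E := D`_2) (r := invn k)
    (d := eprod (polyC \o invn) h (p%:R - 'X)) :
  [/\ (vprod h)`_0 = d`_0,
      (vprod h)`_1 = d`_1 + d`_0 * (- 4 * H + (H - r))
    & (vprod h)`_2 = d`_2 + d`_1 * (- 4 * H + (H - r))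
        + d`_0 * (6 * H ^+ 2 + 4 * E - 4 * H * (H - r) + (E - r * (H - r)))].
Proof.
rewrite /vprod -/d -/D [h.-1]/=.
have D0 : D`_0 = 1 by rewrite eprod_coef0 // coefX.
have -> : D ^+ 4 = D * D * (D * D) by ring.
have [e1 e2] := eprod_opp_pred_coef k.
have e0 : (eprod (polyC \o invn) k (- 'X))`_0 = 1.
  by rewrite eprod_coef0 // coefN coefX oppr0.
move: (eprod _ k _) e0 e1 e2 => m m0; rewrite -/h -/D -/H -/r -/E => m1 m2.
have D1 : D`_1 = - H by rewrite opprK.
have [-> -> ->] := coefM3 (D * D * (D * D) * d) m.
have [-> -> ->] := coefM3 (D * D * (D * D)) d.
have [-> -> ->] := coefM3 (D * D) (D * D).
have [-> -> ->] := coefM3 D D.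
rewrite m0 m1 m2 D1 -/E D0; clear.
by move: H E r (d`_0) (d`_1) (d`_2) => *; split; ring.
Qed.

(** Modulo [p^3] only degrees [3] and [4] survive, so [W_4] and [W_5] involve just the first three
    coefficients of [vprod]. *)
Lemma cert_last (h : nat) (p := h.*2.+1) (P := p%:R : {poly rat}) :
  cert h%:R ('X - h%:R) =
    ((24 * (1 - 3 * p%:R))%:P * 'X + (- 12 * (1 - 4 * p%:R + 3 * p%:R ^+ 2))%:P)
       * 'X^3
    + (p%:R ^+ 3)%:P * (48 * 'X^2 + 48 * (P - 1) * 'X + 16 * (1 - P) ^+ 2).
Proof.
rewrite !(rmorph_nat, rmorphXn, rmorph1, rmorphN, rmorphM, rmorphB, rmorphD).
rewrite /= /P /p !natr_double1 /cert; ring.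
Qed.

Lemma polyOver_vprod (k : nat) (h := k.+1) (p := h.*2.+1) :
  prime p -> vprod h \is a polyOver (plocal p).
Proof.
have kp : (k < p)%N by rewrite /p /h; lia.
have hltp : (h < p)%N by rewrite /p; lia.
move=> pp; have Xp : 'X \is a polyOver (plocal p) by rewrite polyOverX.
have Yp : p%:R - 'X \is a polyOver (plocal p) by rewrite rpredB ?rpred_nat.
by rewrite /vprod !(rpredM, rpredX, polyOver_eprod) ?rpredN.
Qed.

Lemma last_coef (k : nat) (h := k.+1) (p := h.*2.+1) (v : rat)
    (W := v *: vprod h * cert h%:R ('X - h%:R))
    (a := 24 * (1 - 3 * p%:R)) (b := - 12 * (1 - 4 * p%:R + 3 * p%:R ^+ 2)) :
  prime p -> v \in plocal p ->
  pideal p 3 (W`_4 - (a * (v * (vprod h)`_0) + b * (v * (vprod h)`_1)))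
  /\ pideal p 3 (W`_5 - (a * (v * (vprod h)`_1) + b * (v * (vprod h)`_2))).
Proof.
move=> pp vp; rewrite {}/W cert_last -/h -/p -/a -/b; set Q := _ + 16 * _.
have Qp : Q \is a polyOver (plocal p).
  have Xp : 'X \is a polyOver (plocal p) by rewrite polyOverX.
  by rewrite /Q; ploc.
have Vp : vprod h \is a polyOver (plocal p).
  exact: polyOver_vprod.
have -> : v *: vprod h * ((a%:P * 'X + b%:P) * 'X^3 + (p%:R ^+ 3)%:P * Q)
  = v%:P * (vprod h * (a%:P * 'X + b%:P)) * 'X^3 + (p%:R ^+ 3)%:P * (v *: (vprod h * Q)).
  by rewrite -!mul_polyC; ring.
have Rp i : (v *: (vprod h * Q))`_i \in plocal p.
  by rewrite coefZ rpredM //; apply/polyOverP; rewrite rpredM.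
move: (v *: (vprod h * Q) : {poly rat}) Rp => R Rp.
rewrite !coefD !coefMXn !coefCM /=.
have [_ -> ->] := coefM3 (vprod h) (a%:P * 'X + b%:P).
rewrite !coefD !coefCM !coefC !coefX /=.
split; [exists R`_4 | exists R`_5] => //.
all: move: (R`_4) (R`_5) (p%:R ^+ 3) (vprod h) => x y w V.
all: by move: (V`_0) (V`_1) (V`_2) => *; ring.
Qed.

(** * The Fermat quotient through [H] and [E] *)

Lemma plocal_fermat_q2 (p : nat) :
  prime p -> (2 < p)%N -> fermat_q2 p \in plocal p.
Proof.
move=> pp p2; have c2 : coprime 2 p by rewrite coprime_small.
have := Euler_exp_totient c2; rewrite totient_prime // => /eqP.
rewrite eqn_mod_dvd ?expn_gt0 // => /dvdnP[t tE].
rewrite /fermat_q2 -(natrB _ (n := 1)) ?expn_gt0 // tE natrM mulfK ?rpred_nat //.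
by rewrite pnatr_eq0 -lt0n prime_gt0.
Qed.

Lemma fermat_q2_apx (h : nat) (p := h.*2.+1)
    (D := eprod (polyC \o invn) h 'X) (H := - D`_1) (E := D`_2) :
  prime p ->
  apx p (fermat_q2 p) (- H / 2) (3 * E / 4 - H ^+ 2 / 4).
Proof.
move=> pp; have h0 : (0 < h)%N by case: h @p pp {D H E}.
have hp : 2^-1 \in plocal p by rewrite plocalV // coprime2n /p /= odd_double.
have h4 : 4^-1 \in plocal p.
  by rewrite (_ : 4^-1 = 2^-1 ^+ 2) ?rpredX //; field.
have h8 : 8^-1 \in plocal p.
  by rewrite (_ : 8^-1 = 2^-1 ^+ 3) ?rpredX //; field.
have Dp : D \is a polyOver (plocal p).
  by rewrite polyOver_eprod ?polyOverX // /p; lia.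
have Hp : H \in plocal p by rewrite rpredN; apply/polyOverP.
have Ep : E \in plocal p by apply/polyOverP.
have qp : fermat_q2 p \in plocal p by rewrite plocal_fermat_q2 // /p; lia.
have pn0 : p%:R != 0 :> rat by rewrite pnatr_eq0.
have [R Rp DE] := poly_trunc3 _ _ Dp.
have D0 : D`_0 = 1 by rewrite eprod_coef0 // coefX.
have Dx x : D.[x] = 1 - H * x + E * x ^+ 2 + R.[x] * x ^+ 3.
  by rewrite {1}DE !(hornerD, hornerM, hornerC, hornerX) D0 /H /E; ring.
have := eprod_half h; rewrite -/p.
have Dev x : eprod invn h x = D.[x] by rewrite horner_eprod hornerX.
rewrite !Dev.
have -> : 2 ^+ h.*2 = 1 + p%:R * fermat_q2 p :> rat.
  by rewrite /fermat_q2 natrX mulrCA divff // mulr1 addrC subrK.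
rewrite !Dx.
have R1p : R.[p%:R] \in plocal p by rewrite rpred_horner ?rpred_nat.
have R2p : R.[p%:R / 2] \in plocal p by rewrite rpred_horner ?rpredM ?rpred_nat.
move: (R.[p%:R]) (R.[p%:R / 2]) (fermat_q2 p) R1p R2p qp => a b q ap bp qp e.
set c := a - b / 8 - q * E / 4 - p%:R * q * b / 8.
have cp : c \in plocal p by rewrite /c; ploc.
(* This is [D(p) = (1 + p q) D(p/2)] divided by [p]; it is implicit in [q], and substituting it into
   its own linear term gives the expansion. *)
have qE : q = - H / 2 + p%:R * (3 * E / 4 + q * H / 2) + p%:R ^+ 2 * c.
  apply: (mulfI pn0); rewrite /c.
  move: (p%:R) e => w /esym/eqP; rewrite -subr_eq0 => /eqP e.
  by apply/eqP; rewrite -subr_eq0 -e; apply/eqP; field.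
split; ploc.
exists (H / 2 * (3 * E / 4 + q * H / 2 + p%:R * c) + c); first by ploc.
by rewrite {1}qE {1}qE; field.
Qed.

(** * Assembly of the congruence *)

Lemma wzsum_half_congr (k : nat) (h := k.+1) (p := h.*2.+1) : prime p ->
  pideal p 5 (wzsum wzcoef h.+1 2^-1 - (9 * p%:R ^+ 2
    + 6 * p%:R ^+ 3 * fermat_q2 p - 9 * p%:R ^+ 4 * fermat_q2 p ^+ 2)).
Proof.
have kp : (k.+1 < p)%N by rewrite /p /h; lia.
have hltp : (h < p)%N by rewrite /p; lia.
have h2p : (h.*2 < p)%N by [].
move=> pp; pose c : nat -> {poly rat} := polyC \o wzcoef.
have podd : odd p by rewrite /p /= odd_double.
have pn0 : p%:R != 0 :> rat by rewrite pnatr_eq0.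
have hp : 2^-1 \in plocal p by rewrite plocalV // coprime2n.
have crec : wzrec c := wzrec_rmorph _ _ _ _ wzcoef_rec.
have c0 : c 0 = 1.
  by rewrite /c /= /wzcoef muln0 !fact0 expr0 !expr1n !mulr1 ?invr1 ?divr1.
have yp : 'X - h%:R \is a polyOver (plocal p).
  by rewrite rpredB ?rpred_nat ?polyOverX.
pose M := wzsum c h ('X - h%:R).
pose W := vscale h *: vprod h * cert h%:R ('X - h%:R).
have Peq : wzsum c h.+1 ('X - h%:R) = M + p%:R ^- 2 *: ('X * W).
  by rewrite /wzsum big_ord_recr /= wzterm_last.
have Pa a : (wzsum c h.+1 ('X - h%:R)).[a] = wzsum wzcoef h.+1 (a - h%:R).
  transitivity (wzsum (horner_eval a \o c) h.+1 (a - h%:R)).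
    rewrite -[LHS]/(horner_eval a _) rmorph_wzsum; congr (wzsum _ _ _).
    by rewrite /= /horner_eval -polyC_natr !hornerE.
  by apply: eq_bigr => n _; rewrite /wzterm /= /horner_eval hornerC.
pose D : {poly rat} := eprod (polyC \o invn) h 'X.
pose d : {poly rat} := eprod (polyC \o invn) h (p%:R - 'X).
have Xp : 'X \is a polyOver (plocal p) by rewrite polyOverX.
have Dp : D \is a polyOver (plocal p) by rewrite polyOver_eprod.
have rp : invn k \in plocal p by rewrite plocal_invn.
have d0E : d`_0 = eprod invn h p%:R.
  by rewrite -horner_coef0 horner_eprod -polyC_natr !hornerE.
(* [D(p)] is a product of the units [- (p - i) / i]. *)
have d0V : (d`_0)^-1 \in plocal p.
  rewrite d0E /eprod -prodfV; apply: rpred_prod => -[i ih] _ /=.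
  have ip : (i.+1 < p)%N := leq_ltn_trans ih hltp.
  have -> : 1 - invn i * p%:R = - ((p - i.+1)%:R / i.+1%:R).
    by rewrite natrB 1?ltnW // /invn; field; rewrite nat1r pnatr_eq0.
  rewrite invrN rpredN invf_div rpredM ?rpred_nat // plocalV // coprime_small //.
  by rewrite subn_gt0 ip ltn_subrL.
have m1p : apx p (eprod invn k (- p%:R)) 1 (- D`_1 - invn k).
  have mp : eprod (polyC \o invn) k (- 'X) \is a polyOver (plocal p).
    by rewrite polyOver_eprod ?rpredN // ltnW.
  have [R Rp mE] := poly_trunc3 _ _ mp.
  have := horner_eprod k (- 'X) p%:R; rewrite hornerN hornerX => <-.
  have [m1 m2] := eprod_opp_pred_coef k; rewrite -/h -/D in m1 m2.
  rewrite mE eprod_coef0 ?coefN ?coefX ?oppr0 // m1.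
  rewrite !(hornerD, hornerM, hornerC, hornerX).
  have D1p : D`_1 \in plocal p by apply/polyOverP.
  have m2p : (eprod (polyC \o invn) k (- 'X))`_2 \in plocal p by apply/polyOverP.
  have Rpp : R.[p%:R] \in plocal p by rewrite rpred_horner ?rpred_nat.
  split; ploc; exists ((eprod (polyC \o invn) k (- 'X))`_2 + p%:R * R.[p%:R]).
    by ploc.
  by ring.
have vE : vscale h = eprod invn k (- p%:R) * (invn k * (d`_0)^-1) ^+ 2.
  by rewrite /vscale -d0E -invfM exprVn.
have vp : vscale h \in plocal p.
  by rewrite vE; have := apx_local _ _ _ _ m1p => ?; ploc.
have [w4 w5] := last_coef k (vscale h) pp vp.
rewrite -/h -/p -/W in w4 w5.
have [e0 e1 [c2 e2]] : [/\ apx p d`_0 1 D`_1, apx p d`_1 (- D`_1) (- 2 * D`_2)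
    & exists c, apx p d`_2 D`_2 c] by apply: eprod_reflect_coef.
have [v0 v1 v2] := vprod_coef k; rewrite -/h -/p -/D -/d in v0 v1 v2.
have qa := fermat_q2_apx h pp; rewrite -/p -/D in qa.
have sq : pideal p 1 (3 * ((- D`_1) ^+ 2 - 2 * D`_2)).
  by rewrite sqrrN eprod_coef_sqr; apply: sum_invn_sqr.
(* Multiplied by [p^3], this trades the [W] terms of the interpolation for those in the Fermat
   quotient. *)
have key : pideal p 2 (W`_4 / 32 + 3 * p%:R / 64 * W`_5
    + 6 * fermat_q2 p - 9 * p%:R * fermat_q2 p ^+ 2).
  have h5 : 32^-1 \in plocal p.
    by rewrite (_ : 32^-1 = 2^-1 ^+ 5) ?rpredX //; field.
  have h6 : 64^-1 \in plocal p.
    by rewrite (_ : 64^-1 = 2^-1 ^+ 6) ?rpredX //; field.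
  have D1p : - D`_1 \in plocal p by rewrite rpredN; apply/polyOverP.
  have D2p : D`_2 \in plocal p by apply/polyOverP.
  have rE : invn k * (p%:R - 1) = 2.
    by rewrite /p natr_double1 addrK mulrCA invnK mulr1.
  have d0n : (d`_0)^-1 * d`_0 = 1.
    rewrite mulVf ?d0E; first by [].
    have := fact_neq0 rat h.*2; rewrite fact_eprod_subn.
    by apply: contra_neq => ->; rewrite mulr0.
  have {}e0 : apx p d`_0 1 (- - D`_1) by rewrite opprK.
  have := wz_congruence _ _ _ _ _ _ _ _ _ _ _
    hp D1p D2p rp d0V rE d0n e0 e1 e2 m1p qa sq.
  rewrite /= -vE -v2 -v1 -v0 => -[t tp tE].
  have [t4 t4p /eqP] := w4; rewrite subr_eq => /eqP ->.
  have [t5 t5p /eqP] := w5; rewrite subr_eq => /eqP ->.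
  exists (t + (p%:R * t4 / 32 + 3 * p%:R ^+ 2 * t5 / 64)); first by ploc.
  rewrite [RHS]mulrDr -tE; clear.
  move: (vprod h) (vscale h) (fermat_q2 p) => V v q.
  move: (V`_0) (V`_1) (V`_2) (p%:R) => x y z w.
  by field.
have Mp : M \is a polyOver (plocal p) by rewrite polyOver_wzsum.
have Wp : W \is a polyOver (plocal p).
  rewrite /W rpredM ?polyOver_cert ?rpred_nat //.
  by rewrite -mul_polyC rpredM ?polyOverC // polyOver_vprod.
have szf : (size (48 * 'X^2 - 48 * 'X^4 : {poly rat})%R <= 5)%N.
  rewrite -!polyC_natr !mul_polyC.
  rewrite (leq_trans (size_polyD _ _)) // geq_max size_polyN.
  by rewrite !(leq_trans (size_scale_leq _ _)) // size_polyXn.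
have X4 := wzsum_dvdX4 c h h crec c0 (leqnn h).
have P0 := Pa p%:R.
(* The node [p] corresponds to [y = h + 1], the last of the integer zeros. *)
have ph : p%:R - h%:R = h.+1%:R :> rat by rewrite /p natr_double1 -natr1; ring.
rewrite ph wzsum_nat // in P0; last exact: wzcoef_rec.
rewrite Peq in X4 P0.
have [t tp] := pideal_interpolation _ _ _ _ podd Mp Wp szf X4 P0.
rewrite /= -Peq Pa (_ : p%:R / 2 - h%:R = 2^-1); last first.
  by rewrite /p natr_double1; field.
move=> /eqP; rewrite subr_eq => /eqP ->.
have [u up uE] := key; exists (t - u); first by ploc.
rewrite [RHS]mulrBr (_ : p%:R ^+ 5 * u = p%:R ^+ 3 * (p%:R ^+ 2 * u)); last by ring.
(* In [f(p/2) - f(p)/16] the quartic terms cancel and the quadratic ones give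
   [12 p^2 - 3 p^2 = 9 p^2]. *)
rewrite -uE -!polyC_natr !(hornerD, hornerN, hornerM, hornerC, hornerX); clear.
move: (W`_4) (W`_5) (fermat_q2 p) (p%:R) => x y q w.
by field.
Qed.

Theorem theorem1p1 (p : nat) (hp : prime p) (hp2 : (2 < p)%N) :
  rat_congr p 5
    (\sum_(0 <= k < (p.-1)./2.+1)
        ((-1) ^+ k * (172 * (k%:R) ^+ 2 + 75 * k%:R + 9) / (2 ^+ (12 * k))
         * ('C(k.*2, k) ^ 3 * 'C(3 * k, k) * 'C(4 * k, k.*2))%:R : rat))
    (9 * (p%:R) ^+ 2 + 6 * (p%:R) ^+ 3 * fermat_q2 p
       - 9 * (p%:R) ^+ 4 * (fermat_q2 p) ^+ 2).
Proof.
have podd : odd p by case: (even_prime hp) hp2 => [->|].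
have [k pE] : exists k, p = k.+1.*2.+1.
  by exists (p.-1./2.-1); have := odd_double_half p; rewrite podd; lia.
apply: rat_congrP; first exact: prime_gt0.
rewrite -wzsum_half (_ : p.-1./2 = k.+1); last by rewrite pE; lia.
by rewrite pE in hp *; exact: wzsum_half_congr.
Qed.
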